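(* Let $X\subset\mathbb{R}^d$ be a compact subset with nonempty interior, $Y=\{-1,1\}$, and for $\sigma\ge1$ let $H_\sigma(X)$ be the RKHS of the Gaussian RBF kernel $k_\sigma$ on $X$. Then for all $0<p\le2$ and all $\delta>0$ there exists a constant $c_{p,\delta,d}>0$ independent of $\sigma$ such that for all $\sigma\ge 1$, all $n\ge1$ and all $\varepsilon>0$ we have $$\sup_{T\in(X\times Y)^n}\log\mathcal{N}\big(B_{H_\sigma(X)},\varepsilon,L_2(T_X)\big)\le c_{p,\delta,d}\,\sigma^{(1-p/2)(1+\delta)d}\,\varepsilon^{-p}.$$
   Context: $k_\sigma(x,x')=\exp(-\sigma^2\|x-x'\|_2^2)$, $x,x'\in X$. $B_E$ denotes the closed unit ball of a normed space $E$. For a subset $A$ of a (semi)normed space $E$, $\mathcal{N}(A,\varepsilon,E):=\min\{n\ge1:\exists x_1,\dots,x_n\in E\text{ with }A\subset\bigcup_{i=1}^n(x_i+\varepsilon B_E)\}$. For $T=((x_1,y_1),\dots,(x_n,y_n))\in(X\times Y)^n$, $L_2(T_X)$ is the $L_2$-space with respect to the empirical measure $\frac1n\sum_i\delta_{x_i}$, i.e. with norm $\|f\|_{L_2(T_X)}=(\frac1n\sum_{i=1}^n|f(x_i)|^2)^{1/2}$; functions in $H_\sigma(X)$ are identified with their classes in $L_2(T_X)$. The set $X$ is fixed, so the constant may depend on $X$ (besides $p,\delta,d$), but not on $\sigma$, $n$, $\varepsilon$. *)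

(* Defs.v *)
From mathcomp Require Import all_boot all_order all_algebra.
From mathcomp Require Import all_classical all_reals all_analysis.
Set Implicit Arguments.
Unset Strict Implicit.
Unset Printing Implicit Defensive.
Import Order.TTheory GRing.Theory Num.Theory.
Import numFieldNormedType.Exports.
Local Open Scope classical_set_scope.
Local Open Scope ring_scope.

Definition labels (R : realType) : set R := [set -1; 1].
Arguments labels : clear implicits.

(* 'rV[R]_d carries the sup norm in the library, hence the explicit sum. *)
Definition l2norm (R : realType) (d : nat) (v : 'rV[R]_d) : R :=
  Num.sqrt (\sum_(i < d) `|v ord0 i| ^+ 2).

Definition gauss_kernel (R : realType) (d : nat) (X : set 'rV[R]_d)
    (sigma : R) (x x' : X) : R :=
  expR (- (sigma ^+ 2 * l2norm (val x - val x') ^+ 2)).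

Definition ip_norm (R : realType) (U : Type) (ip : U -> U -> R) (f : U) : R :=
  Num.sqrt (ip f f).

(* A Hilbert space whose elements are functions on S is given by its carrier
   H, a set of functions, together with its inner product; the values of ip
   outside of H are irrelevant. *)
Record hilbert_function_space (R : realType) (S : Type)
    (H : set (S -> R)) (ip : (S -> R) -> (S -> R) -> R) : Prop := {
  hfs_zero : H 0 ;
  hfs_lin : forall (a : R) (f g : S -> R), H f -> H g -> H (a *: f + g) ;
  hfs_ip_sym : forall f g : S -> R, H f -> H g -> ip f g = ip g f ;
  hfs_ip_lin : forall (a : R) (f g h : S -> R), H f -> H g -> H h ->
    ip (a *: f + g) h = a * ip f h + ip g h ;
  hfs_ip_ge0 : forall f : S -> R, H f -> 0 <= ip f f ;
  hfs_ip_def : forall f : S -> R, H f -> ip f f = 0 -> f = 0 ;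
  hfs_complete : forall u : nat -> S -> R,
    (forall n, H (u n)) ->
    (forall e : R, 0 < e -> exists N : nat, forall m n : nat,
       (N <= m)%N -> (N <= n)%N -> ip_norm ip (u m - u n) < e) ->
    exists2 f : S -> R, H f & ip_norm ip (u n - f) @[n --> \oo] --> (0 : R) }.

(* (H, ip) is the reproducing kernel Hilbert space of k; for a given positive
   definite k, these conditions determine H, and ip on H, uniquely. *)
Record is_RKHS (R : realType) (S : Type) (k : S -> S -> R)
    (H : set (S -> R)) (ip : (S -> R) -> (S -> R) -> R) : Prop := {
  rkhs_hilbert : hilbert_function_space H ip ;
  rkhs_kernel : forall x : S, H (fun x' => k x' x) ;
  rkhs_reproducing : forall (f : S -> R) (x : S),
    H f -> f x = ip f (fun x' => k x' x) }.

Definition hilbert_ball (R : realType) (S : Type)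
    (H : set (S -> R)) (ip : (S -> R) -> (S -> R) -> R) : set (S -> R) :=
  [set f | H f /\ ip_norm ip f <= 1].

(* The infimum of a set of positive integers in \bar R is its minimum, and is
   +oo if the set is empty (no finite cover). For eps > 0,
   nrm (f - x i) <= eps says that f lies in x i + eps * (unit ball of nrm). *)
Definition covering_number (R : realType) (E : zmodType) (nrm : E -> R)
    (A : set E) (eps : R) : \bar R :=
  ereal_inf [set (m%:R)%:E | m in [set m : nat | (1 <= m)%N /\
    exists x : 'I_m -> E,
      A `<=` \bigcup_(i in [set: 'I_m]) [set f | nrm (f - x i) <= eps]]].

(* A seminorm on functions: passing to classes in L_2(T_X) identifies the
   functions at distance 0, which does not change covering numbers. *)
Definition empirical_L2 (R : realType) (S Y : Type) (n : nat)
    (T : n.-tuple (S * Y)) (f : S -> R) : R :=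
  Num.sqrt (n%:R^-1 * \sum_(i < n) `|f (tnth T i).1| ^+ 2).

(* Main.v *)
(* The two endpoint bounds
     (a) log N(eps) <= 1 + 16 eps^-2, uniformly in sigma, and
     (b) log N(eps) <= C sigma^((1+a)d) eps^-a, for every a > 0,
   are interpolated: log N <= a^theta b^(1-theta) with theta = (1-p/2)/(1-a/2).

   (a) On the sample, the unit ball is an ellipsoid {sum_j w_j e_j : |w| <= 1},
   with (e_j) an orthonormal basis of the span of the kernels at the sample
   points, and sum_j |e_j|^2 <= 1 in L_2(T_X). For uniform random signs s, the
   element G = sum_j s_j e_j falls within 2 of lam f with probability at least
   exp(-lam^2)/2, for every f in the ball: this holds with probability 3/4 once
   the s_j are biased so that G has mean lam f, and the density of the biased
   signs has second moment at most exp(lam^2). If lam = 4/eps, these events are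
   disjoint for eps-separated f, so there are at most 2 exp(lam^2) of them (a
   discrete form of the proof of the dual Sudakov inequality).

   (b) If the kernel is within eps^2/4 of a kernel of rank N, then the ball is
   within eps/2 of an N-dimensional subspace of L_2(T_X), where a grid covers
   it. Taylor expansion of the one-dimensional Gaussian on cells of length
   1/(4 sigma) gives rank O((sigma log(1/eps))^d). *)

Require Import Defs.
From mathcomp Require Import all_boot all_order all_algebra.
From mathcomp Require Import all_classical all_reals all_analysis.
From mathcomp Require Import ring lra.
Import Order.TTheory GRing.Theory Num.Theory.
Import numFieldNormedType.Exports.
Local Open Scope classical_set_scope.
Local Open Scope ring_scope.

(** * Packings of ellipsoids *)

Section TiltedSigns.
Context {R : realType} {J : finType}.
Implicit Types (theta a : J -> R) (s : {ffun J -> bool}).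

Definition sgnb (b : bool) : R := if b then 1 else -1.

(** Density, relative to uniform signs, of the law of independent signs with mean [theta j] at [j].
    It is nonnegative once all |theta_j| <= 1. *)
Definition tilt theta s : R := \prod_j (1 + theta j * sgnb (s j)).

Definition signs_mean (F : {ffun J -> bool} -> R) : R :=
  2^-1 ^+ #|J| * \sum_s F s.

Lemma signs_mean_prod (g : J -> bool -> R) :
  signs_mean (fun s => \prod_j g j (s j)) =
  \prod_j (2^-1 * (g j true + g j false)).
Proof.
rewrite /signs_mean -(bigA_distr_bigA g) big_split prodr_const /=; congr (_ * _).
by apply: eq_bigr => j _; rewrite big_bool.
Qed.

Lemma signs_mean_sum (I : Type) (r : seq I) (F : I -> {ffun J -> bool} -> R) :
  signs_mean (fun s => \sum_(i <- r) F i s) =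
  \sum_(i <- r) signs_mean (F i).
Proof. by rewrite /signs_mean exchange_big mulr_sumr. Qed.

Lemma signs_meanZ (c : R) (F : {ffun J -> bool} -> R) :
  signs_mean (fun s => c * F s) = c * signs_mean F.
Proof. by rewrite /signs_mean -mulr_sumr mulrCA. Qed.

Lemma signs_meanD (F G : {ffun J -> bool} -> R) :
  signs_mean (fun s => F s + G s) = signs_mean F + signs_mean G.
Proof. by rewrite /signs_mean big_split mulrDr. Qed.

Lemma ler_signs_mean (F G : {ffun J -> bool} -> R) :
  (forall s, F s <= G s) -> signs_mean F <= signs_mean G.
Proof.
move=> FG; rewrite /signs_mean ler_wpM2l ?exprn_ge0 ?invr_ge0//.
by apply: ler_sum => s _.
Qed.

Lemma signs_mean_cst (c : R) : signs_mean (fun=> c) = c.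
Proof.
rewrite /signs_mean sumr_const card_ffun card_bool -[c *+ _]mulr_natl natrX mulrA.
by rewrite -exprMn mulVf ?pnatr_eq0// expr1n mul1r.
Qed.

Lemma signs_mean_tilt theta : signs_mean (tilt theta) = 1.
Proof.
rewrite (signs_mean_prod (fun j b => 1 + theta j * sgnb b)) big1// => j _.
by rewrite /sgnb; field.
Qed.

(** The cost of the change of measure: each coordinate contributes 1 + theta_j^2 <=
    exp(theta_j^2). *)
Lemma signs_mean_tilt_sqr theta :
  signs_mean (fun s => tilt theta s ^+ 2) <= expR (\sum_j theta j ^+ 2).
Proof.
under [X in signs_mean X]eq_fun do rewrite /tilt -prodrXl.
rewrite (signs_mean_prod (fun j b => (1 + theta j * sgnb b) ^+ 2)) expR_sum.
apply: ler_prod => j _; rewrite (_ : 2^-1 * _ = 1 + theta j ^+ 2).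
  by rewrite expR_ge1Dx andbT addr_ge0// sqr_ge0.
by rewrite /sgnb; field.
Qed.

Lemma tilt_ge0 theta s : (forall j, theta j ^+ 2 <= 1) -> 0 <= tilt theta s.
Proof.
move=> t1; apply: prodr_ge0 => j _.
have : `|theta j| <= 1
  by rewrite -(@ler_sqr _ `|theta j|) ?nnegrE// real_normK ?num_real// expr1n.
by rewrite ler_norml /sgnb; case: (s j) => /andP[? ?]; lra.
Qed.

Lemma signs_mean_tilt_cov theta (j k : J) :
  signs_mean (fun s => tilt theta s *
    ((sgnb (s j) - theta j) * (sgnb (s k) - theta k))) =
  if j == k then 1 - theta j ^+ 2 else 0.
Proof.
(* The integrand becomes a product over coordinates, so that independence applies: the centred
   factor enters at [l = j] and at [l = k], twice if they agree. *)
pose g l b : R := (1 + theta l * sgnb b) *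
  ((if l == j then sgnb b - theta l else 1) *
   (if l == k then sgnb b - theta l else 1)).
rewrite (_ : (fun s => _) = (fun s => \prod_l g l (s l))); last first.
  apply/funext => s; rewrite /g !big_split /=; congr (_ * (_ * _)).
    by rewrite -big_mkcond big_pred1_eq.
  by rewrite -big_mkcond big_pred1_eq.
rewrite (signs_mean_prod g) (bigD1 j)//=.
have [jk|/negPf jk] := eqVneq j k; last first.
  by rewrite {1 2}/g eqxx jk /sgnb (_ : 2^-1 * _ = 0) ?mul0r//; field.
rewrite big1 => [|l /negPf lj]; first by rewrite /g -jk eqxx /sgnb; field.
by rewrite /g -jk lj /sgnb; field.
Qed.

(** Under the tilted law the centred signs are uncorrelated with variance at most 1, so the cross
    terms of the square vanish. *)
Lemma signs_mean_tilt_var theta a :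
  signs_mean (fun s => tilt theta s *
    (\sum_j a j * (sgnb (s j) - theta j)) ^+ 2) <= \sum_j a j ^+ 2.
Proof.
rewrite (_ : (fun s => _) = (fun s => \sum_j \sum_k (a j * a k) *
  (tilt theta s * ((sgnb (s j) - theta j) * (sgnb (s k) - theta k))))); last first.
  apply/funext => s; rewrite expr2 mulr_suml mulr_sumr; apply: eq_bigr => j _.
  by rewrite mulr_sumr mulr_sumr; apply: eq_bigr => k _; ring.
rewrite signs_mean_sum; apply: ler_sum => j _.
rewrite signs_mean_sum (bigD1 j)//= big1 => [|k /negPf kj].
  rewrite signs_meanZ signs_mean_tilt_cov eqxx addr0 -expr2.
  by rewrite ler_piMr ?sqr_ge0// gerBl sqr_ge0.
by rewrite signs_meanZ signs_mean_tilt_cov eq_sym kj mulr0.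
Qed.

(** Markov's inequality gives [D s <= 4] probability at least 3/4 under the tilted law. The second
    moment of the density transfers this to uniform signs, leaving at least exp(-L)/2. *)
Lemma tilted_chebyshev theta (D : {ffun J -> bool} -> R) :
  (forall j, theta j ^+ 2 <= 1) -> (forall s, 0 <= D s) ->
  signs_mean (fun s => tilt theta s * D s) <= 1 ->
  expR (- \sum_j theta j ^+ 2) <=
    2 * signs_mean (fun s => (D s <= 4)%R%:R).
Proof.
move=> t1 D0 D1; set L := \sum_j _.
have le1 : 1 <= signs_mean (fun s => tilt theta s * (D s <= 4)%R%:R) + 4^-1.
  rewrite -[leLHS](signs_mean_tilt theta).
  apply: (@le_trans _ _ (signs_mean (fun s => tilt theta s * (D s <= 4)%R%:R) +
    4^-1 * signs_mean (fun s => tilt theta s * D s))); last by lra.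
  rewrite -signs_meanZ -signs_meanD; apply: ler_signs_mean => s.
  rewrite mulrCA -mulrDr ler_peMr ?tilt_ge0//.
  by have [_|] := lerP (D s) 4 => /=; rewrite ?mulr0n ?mulr1n; have := D0 s; lra.
(* AM-GM with the weight exp(-L) replaces the Cauchy-Schwarz inequality. *)
have le2 : signs_mean (fun s => tilt theta s * (D s <= 4)%R%:R) <=
    2^-1 * expR (- L) * signs_mean (fun s => tilt theta s ^+ 2) +
    2^-1 * expR L * signs_mean (fun s => (D s <= 4)%R%:R).
  rewrite -!signs_meanZ -signs_meanD; apply: ler_signs_mean => s.
  set t := tilt _ _; case: (D s <= 4); last first.
    by rewrite !mulr0 addr0 mulr_ge0 ?sqr_ge0// mulr_ge0 ?expR_ge0// invr_ge0.
  rewrite !mulr1 expRN; set x := expR L.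
  have x0 : 0 < x by exact: expR_gt0.
  rewrite -subr_ge0 (_ : _ - _ = (t - x) ^+ 2 / (2 * x)); last first.
    by field; rewrite gt_eqF.
  by rewrite divr_ge0 ?sqr_ge0// mulr_ge0// ltW.
have le3 : expR (- L) * signs_mean (fun s => tilt theta s ^+ 2) <= 1.
  by rewrite expRN mulrC ler_pdivrMr ?expR_gt0// mul1r signs_mean_tilt_sqr.
rewrite expRN -[_^-1]mul1r ler_pdivrMr ?expR_gt0//.
set P := signs_mean (fun s => (D s <= 4)%R%:R) in le2 *.
set Q := signs_mean (fun s => tilt theta s ^+ 2) in le2 le3.
rewrite (_ : 2^-1 * expR (- L) * Q = 2^-1 * (expR (- L) * Q)) in le2; last by ring.
by lra.
Qed.

End TiltedSigns.

(** * Counting separated points by disjoint events *)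

Section PackingBound.
Context {R : realType}.

Lemma sqr_subr_le (x y : R) : (x - y) ^+ 2 <= 2 * x ^+ 2 + 2 * y ^+ 2.
Proof.
rewrite -subr_ge0 (_ : _ - _ = (x + y) ^+ 2) ?sqr_ge0//.
by ring.
Qed.

(** [D k s] is the squared empirical distance between the random point with coordinates [sgnb (s j)]
    and lam w_k. Tilting by lam w_k gives it mean at most 1, so each event [D k s <= 4] has uniform
    probability at least exp(-lam^2)/2, and the separation makes these events disjoint. Flatness,
    |lam w_k(j)| <= 1, keeps the tilt nonnegative. *)
Lemma flat_ellipsoid_packing (n N : nat) (J : finType) (a : 'I_n -> J -> R)
    (lam : R) (w : 'I_N -> J -> R) :
  (forall i, \sum_j a i j ^+ 2 <= 1) -> (forall k, \sum_j w k j ^+ 2 <= 1) ->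
  (forall k j, (lam * w k j) ^+ 2 <= 1) ->
  (forall k l, k != l ->
    16 < lam ^+ 2 * (n%:R^-1 * \sum_i (\sum_j a i j * (w k j - w l j)) ^+ 2)) ->
  N%:R <= 2 * expR (lam ^+ 2).
Proof.
move=> a1 w1 lw sep.
pose D k (s : {ffun J -> bool}) : R :=
  n%:R^-1 * \sum_i (\sum_j a i j * (sgnb (s j) - lam * w k j)) ^+ 2.
have D0 k s : 0 <= D k s.
  by rewrite mulr_ge0 ?invr_ge0//; apply: sumr_ge0 => i _; rewrite sqr_ge0.
have mean_le k : signs_mean (fun s => tilt (fun j => lam * w k j) s * D k s) <= 1.
  rewrite (_ : (fun s => _) = fun s => n%:R^-1 * \sum_i
    (tilt (fun j => lam * w k j) s *
     (\sum_j a i j * (sgnb (s j) - lam * w k j)) ^+ 2)); last first.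
    by apply/funext => s; rewrite /D mulrCA mulr_sumr.
  rewrite signs_meanZ signs_mean_sum.
  (* For an empty sample [n%:R^-1] is 0, so [D] vanishes. *)
  have [n0|n0] := posnP n.
    by rewrite (_ : n%:R^-1 = 0 :> R) ?mul0r// n0 invr0.
  rewrite ler_pdivrMl ?ltr0n// mulr1.
  rewrite [leRHS](_ : _ = \sum_(i < n) 1); last by rewrite sumr_const card_ord.
  apply: ler_sum => i _; apply: le_trans (a1 i).
  exact: (signs_mean_tilt_var _ (a i)).
have big k : expR (- lam ^+ 2) <= 2 * signs_mean (fun s => (D k s <= 4)%R%:R).
  apply: le_trans (tilted_chebyshev _ _ (lw k) (D0 k) (mean_le k)).
  rewrite ler_expR lerN2; under eq_bigr do rewrite exprMn.
  by rewrite -mulr_sumr ler_piMr ?sqr_ge0.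
(* Two points within squared distance 4 of the same random point are within squared distance 2 * 4 +
   2 * 4 = 16 of each other. *)
have disj k l s : D k s <= 4 -> D l s <= 4 -> k = l.
  move=> Dk Dl; apply/eqP/negPn/negP => /sep; apply/negP; rewrite -leNgt.
  apply: (@le_trans _ _ (2 * D k s + 2 * D l s)); last by lra.
  rewrite /D !(mulrCA _ n%:R^-1) -mulrDr ler_wpM2l ?invr_ge0//.
  rewrite !mulr_sumr -big_split /=; apply: ler_sum => i _.
  rewrite addrC; apply: le_trans (sqr_subr_le _ _).
  rewrite -exprMn le_eqVlt; apply/orP; left; apply/eqP; congr (_ ^+ 2).
  by rewrite -sumrB mulr_sumr; apply: eq_bigr => j _; ring.
have tot : \sum_(k < N) signs_mean (fun s => (D k s <= 4)%R%:R) <= 1 :> R.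
  apply: (@le_trans _ _ (signs_mean (fun s => \sum_(k < N) (D k s <= 4)%R%:R))).
    by rewrite signs_mean_sum.
  rewrite -[leRHS](@signs_mean_cst R J 1).
  apply: ler_signs_mean => s.
  have [[k Dk]|noD] := pselect (exists k, D k s <= 4).
    rewrite (bigD1 k)//= Dk big1 ?addr0// => l lk.
    by apply/eqP; rewrite pnatr_eq0 eqb0; apply: contra lk => /(disj _ _ _ Dk) ->.
  rewrite big1// => k _; apply/eqP; rewrite pnatr_eq0 eqb0.
  by apply/negP => Dk; apply: noD; exists k.
have : N%:R * expR (- lam ^+ 2) <= 2.
  apply: (@le_trans _ _ (2 * \sum_(k < N) signs_mean (fun s => (D k s <= 4)%R%:R))).
    rewrite mulr_natl -[N in X in X <= _]card_ord -sumr_const mulr_sumr.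
    exact: ler_sum.
  by lra.
by rewrite expRN ler_pdivrMr ?expR_gt0.
Qed.

(* Splitting every coordinate into M equal ones makes the coordinates of the
   points as small as flat_ellipsoid_packing needs them. *)
Lemma ellipsoid_packing (n N : nat) (J : finType) (a : 'I_n -> J -> R)
    (lam : R) (w : 'I_N -> J -> R) :
  (forall i, \sum_j a i j ^+ 2 <= 1) -> (forall k, \sum_j w k j ^+ 2 <= 1) ->
  (forall k l, k != l ->
    16 < lam ^+ 2 * (n%:R^-1 * \sum_i (\sum_j a i j * (w k j - w l j)) ^+ 2)) ->
  N%:R <= 2 * expR (lam ^+ 2).
Proof.
move=> a1 w1 sep.
(* As M > lam^2, each split coordinate satisfies (lam c w)^2 <= lam^2 / M <= 1, and c^2 = 1/M lets
   the M equal copies add up to the original sums. *)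
pose M := (Num.truncn (lam ^+ 2)).+1.
pose c : R := Num.sqrt M%:R^-1.
have c2 : c ^+ 2 = M%:R^-1 by rewrite sqr_sqrtr// invr_ge0.
have split (F : J -> R) : \sum_(jl : J * 'I_M) c ^+ 2 * F jl.1 = \sum_j F j.
  rewrite -(pair_bigA _ (fun j (l : 'I_M) => c ^+ 2 * F j)) /=.
  apply: eq_bigr => j _; rewrite sumr_const card_ord -mulr_natl mulrA c2 mulfV ?mul1r//.
  by rewrite pnatr_eq0.
apply: (@flat_ellipsoid_packing n N (J * 'I_M)%type (fun i jl => c * a i jl.1) lam
  (fun k jl => c * w k jl.1)).
- by move=> i; under eq_bigr do rewrite exprMn; rewrite (split (fun j => a i j ^+ 2)).
- by move=> k; under eq_bigr do rewrite exprMn; rewrite (split (fun j => w k j ^+ 2)).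
- move=> k [j l] /=; rewrite !exprMn c2 mulrCA ler_pdivrMl ?ltr0n// mulr1.
  apply: (@le_trans _ _ (lam ^+ 2)); last by rewrite ltW// truncnS_gt.
  rewrite ler_piMr ?sqr_ge0// (le_trans _ (w1 k))// (bigD1 j)//=.
  by rewrite lerDl sumr_ge0// => ? _; rewrite sqr_ge0.
- move=> k l kl; have := sep _ _ kl; congr (16 < _ * (_ * _)).
  apply: eq_bigr => i _; congr (_ ^+ 2).
  rewrite -(split (fun j => a i j * (w k j - w l j))).
  by apply: eq_bigr => jl _; ring.
Qed.

End PackingBound.

(** * Positive semidefinite forms *)

Section SemiInner.
Context {R : realType} {V : lmodType R}.
Set Implicit Arguments.
Unset Strict Implicit.

(** Definiteness is left out so that one theory serves both the RKHS inner product and the empirical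
    one, where nonzero functions can be null. *)
Record semi_inner (H : set V) (b : V -> V -> R) : Prop := {
  semi_inner_zero : H 0 ;
  semi_inner_closed : forall (a : R) f g, H f -> H g -> H (a *: f + g) ;
  semi_inner_sym : forall f g, H f -> H g -> b f g = b g f ;
  semi_inner_lin : forall (a : R) f g h, H f -> H g -> H h ->
    b (a *: f + g) h = a * b f h + b g h ;
  semi_inner_ge0 : forall f, H f -> 0 <= b f f }.

Variables (H : set V) (b : V -> V -> R).
Hypothesis Hb : semi_inner H b.

Let H0 := semi_inner_zero Hb.

Lemma semi_inner_mem_sum (I : Type) (r : seq I) (a : I -> R) (F : I -> V) :
  (forall i, H (F i)) -> H (\sum_(i <- r) a i *: F i).
Proof.
move=> HF; elim: r => [|i r IH]; first by rewrite big_nil.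
by rewrite big_cons; apply: (semi_inner_closed Hb).
Qed.

Lemma semi_inner0l g : H g -> b 0 g = 0.
Proof.
move=> Hg; have := semi_inner_lin Hb 1 H0 H0 Hg.
by rewrite scaler0 addr0 mul1r => h; lra.
Qed.

Lemma semi_innerDl f g h : H f -> H g -> H h -> b (f + g) h = b f h + b g h.
Proof.
by move=> Hf Hg Hh; rewrite -[f]scale1r (semi_inner_lin Hb)// scale1r mul1r.
Qed.

Lemma semi_innerZl a f h : H f -> H h -> b (a *: f) h = a * b f h.
Proof.
move=> Hf Hh; rewrite -[a *: f]addr0 (semi_inner_lin Hb)// semi_inner0l//.
by rewrite addr0.
Qed.

Lemma semi_inner_memZ a f : H f -> H (a *: f).
Proof. by move=> Hf; rewrite -[a *: f]addr0; apply: (semi_inner_closed Hb). Qed.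

Lemma semi_inner_memB f g : H f -> H g -> H (f - g).
Proof.
by move=> Hf Hg; rewrite -scaleN1r addrC; apply: (semi_inner_closed Hb).
Qed.

Lemma semi_innerBl f g h : H f -> H g -> H h -> b (f - g) h = b f h - b g h.
Proof.
move=> Hf Hg Hh; rewrite -scaleN1r addrC (semi_inner_lin Hb)//.
by rewrite mulN1r addrC.
Qed.

Lemma semi_inner_sqrD_le f g : H f -> H g ->
  b (f + g) (f + g) <= 2 * b f f + 2 * b g g.
Proof.
move=> Hf Hg; have HD : H (f + g).
  by rewrite -[f]scale1r; apply: (semi_inner_closed Hb).
have HB := semi_inner_memB Hf Hg; have := semi_inner_ge0 Hb HB.
rewrite (semi_innerBl Hf Hg HB) (semi_innerDl Hf Hg HD).
rewrite (semi_inner_sym Hb Hf HB) (semi_inner_sym Hb Hg HB).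
rewrite (semi_inner_sym Hb Hf HD) (semi_inner_sym Hb Hg HD).
rewrite !semi_innerBl// !semi_innerDl// (semi_inner_sym Hb Hg Hf).
by move=> h; lra.
Qed.

Lemma semi_inner_suml (I : Type) (r : seq I) (a : I -> R) (F : I -> V) h :
  (forall i, H (F i)) -> H h ->
  b (\sum_(i <- r) a i *: F i) h = \sum_(i <- r) a i * b (F i) h.
Proof.
move=> HF Hh; elim: r => [|i r IH]; first by rewrite !big_nil semi_inner0l.
rewrite !big_cons (semi_inner_lin Hb)// ?IH//.
exact: semi_inner_mem_sum.
Qed.

Lemma semi_inner_cauchy_schwarz f g : H f -> H g -> b f g ^+ 2 <= b f f * b g g.
Proof.
move=> Hf Hg.
have quad t : 0 <= t ^+ 2 * b f f - 2 * t * b f g + b g g.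
  have Htf := semi_inner_memZ t Hf.
  have Hd := semi_inner_memB Htf Hg.
  have := semi_inner_ge0 Hb Hd.
  rewrite semi_innerBl// (semi_inner_sym Hb Htf Hd) (semi_inner_sym Hb Hg Hd).
  rewrite !semi_innerBl// !semi_innerZl// (semi_inner_sym Hb Hf Htf).
  by rewrite (semi_inner_sym Hb Hg Htf) !semi_innerZl// => h; lra.
have [ff0|ff0] := eqVneq (b f f) 0.
  rewrite ff0 mul0r; have [->|fg0] := eqVneq (b f g) 0; first by rewrite expr0n.
  (* The quadratic is affine here, and this argument gives it the value -1. *)
  have := quad ((b g g + 1) / (2 * b f g)).
  rewrite ff0 mulr0 add0r (_ : 2 * _ * b f g = b g g + 1); last by field.
  by move=> h; lra.
have ffp : 0 < b f f by rewrite lt0r ff0 (semi_inner_ge0 Hb).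
have := quad (b f g / b f f).
rewrite (_ : _ + _ = b g g - b f g ^+ 2 / b f f); last by field.
by rewrite subr_ge0 ler_pdivrMr// mulrC.
Qed.

Lemma semi_inner_null f g : H f -> H g -> b f f = 0 -> b g f = 0.
Proof.
move=> Hf Hg f0; have := semi_inner_cauchy_schwarz Hg Hf.
by rewrite f0 mulr0 => h; apply/eqP; rewrite -sqrf_eq0 eq_le h sqr_ge0.
Qed.

(** Parseval's identity for [u], tested against all of [H]: [u] lies in the span of the first [m]
    vectors up to a null vector. For [u = e i] it takes the place of orthonormality. *)
Definition expands (e : nat -> V) (m : nat) (u : V) : Prop :=
  forall f, H f -> b f u = \sum_(j < m) b f (e j) * b u (e j).

(* Orthonormal up to null vectors: some of the e j may have b (e j) (e j) = 0. *)
Lemma gram_schmidt (v : nat -> V) (m : nat) : (forall i, H (v i)) ->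
  exists e : nat -> V, [/\ forall i, H (e i),
    forall i, (i < m)%N -> expands e m (e i) &
    forall i, (i < m)%N -> expands e m (v i)].
Proof.
move=> Hv; elim: m => [|m [e [He ee ev]]]; first by exists v; split.
(* The residual of [v m], shown below to be orthogonal to every [e j] and [v j] with [j < m]. *)
pose r := v m - \sum_(j < m) b (v m) (e j) *: e j.
have Hsum : H (\sum_(j < m) b (v m) (e j) *: e j).
  exact: semi_inner_mem_sum.
have Hr : H r by exact: semi_inner_memB.
have bvm f : H f -> b f (v m) = b f r + \sum_(j < m) b f (e j) * b (v m) (e j).
  move=> Hf; rewrite (semi_inner_sym Hb) // [b f r](semi_inner_sym Hb)//.
  rewrite semi_innerBl// semi_inner_suml// -[LHS](subrK (\sum_(j < m) b (v m) (e j) * b (e j) f)).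
  congr (_ + _); apply: eq_bigr => j _.
  by rewrite mulrC (semi_inner_sym Hb).
have ber j : (j < m)%N -> b (e j) r = 0.
  move=> jm; have := bvm _ (He j); rewrite (semi_inner_sym Hb)// (ee _ jm)//.
  rewrite (eq_bigr (fun i : 'I_m => b (e j) (e i) * b (v m) (e i))).
    by move/eqP; rewrite -subr_eq subrr => /eqP.
  by move=> i _; rewrite mulrC.
have bvr j : (j < m)%N -> b (v j) r = 0.
  move=> jm; rewrite (semi_inner_sym Hb)// (ev _ jm)// big1// => i _.
  by rewrite [b r _](semi_inner_sym Hb)// ber// mul0r.
(* A null residual is orthogonal to all of [H], and the vector 0 is appended; otherwise the
   normalised residual is appended, with [d] the norm of [r]. *)
pose c := if b r r == 0 then 0 else (Num.sqrt (b r r))^-1.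
have [c0|[d [cd cr dr]]] : (forall f, H f -> b f r = 0) /\ c = 0 \/
    exists d, [/\ c * d = 1, b r r = d ^+ 2 & c = d^-1].
  rewrite /c; have [r0|r0] := eqVneq (b r r) 0.
    by left; split=> // f Hf; exact: semi_inner_null.
  right; have rp : 0 < b r r by rewrite lt0r r0 (semi_inner_ge0 Hb).
  exists (Num.sqrt (b r r)); split=> //; last by rewrite sqr_sqrtr// ltW.
  by rewrite mulVf// gt_eqF// sqrtr_gt0.
- pose e' i := if (i < m)%N then e i else 0.
  have e'0 f : H f -> b f (e' m) = 0.
    by move=> Hf; rewrite /e' ltnn (semi_inner_sym Hb)// semi_inner0l.
  have widen u : expands e m u -> expands e' m.+1 u.
    move=> eu f Hf; rewrite (eu _ Hf) big_ord_recr /= e'0// mul0r addr0.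
    by apply: eq_bigr => j _; rewrite /e' ltn_ord.
  exists e'; split=> [i|i|i].
  + by rewrite /e'; case: ifP.
  + rewrite ltnS leq_eqVlt => /predU1P[->|im]; last first.
      by rewrite {2}/e' im; exact/widen/ee.
    move=> f Hf; rewrite e'0// big1// => j _.
    by rewrite [X in _ * X](_ : _ = 0) ?mulr0// /e' ltnn semi_inner0l//; case: ifP.
  + rewrite ltnS leq_eqVlt => /predU1P[->|im]; last exact/widen/ev.
    by apply: widen => f Hf; rewrite bvm// c0.1// add0r.
- pose e' i := if (i < m)%N then e i else c *: r.
  have He' i : H (e' i) by rewrite /e'; case: ifP => // _; exact: semi_inner_memZ.
  have e'm f : H f -> b f (e' m) = c * b f r.
    move=> Hf; rewrite /e' ltnn (semi_inner_sym Hb)//; last exact: semi_inner_memZ.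
    by rewrite semi_innerZl// (semi_inner_sym Hb).
  have e'e j : (j < m)%N -> e' j = e j by rewrite /e' => ->.
  have widen u : H u -> b u r = 0 -> expands e m u -> expands e' m.+1 u.
    move=> Hu ur eu f Hf; rewrite (eu _ Hf) big_ord_recr /= !e'm// ur !mulr0 addr0.
    by apply: eq_bigr => j _; rewrite e'e.
  exists e'; split=> [//|i|i].
  + rewrite ltnS leq_eqVlt => /predU1P[->|im]; last first.
      by rewrite e'e//; apply: widen => //; [exact: ber|exact: ee].
    move=> f Hf; rewrite big_ord_recr /= big1 => [|j _].
      rewrite add0r [X in _ * X](_ : _ = 1) ?mulr1//.
      rewrite e'm// /e' ltnn semi_innerZl// cr -[RHS](expr1n _ 2) -cd.
      by rewrite exprMn; ring.
    rewrite e'e// [X in _ * X](_ : _ = 0) ?mulr0//.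
    by rewrite (semi_inner_sym Hb)// e'm// ber// mulr0.
  + rewrite ltnS leq_eqVlt => /predU1P[->|im]; last first.
      by apply: widen => //; [exact: bvr|exact: ev].
    move=> f Hf; rewrite bvm// big_ord_recr /= addrC; congr (_ + _).
      rewrite !e'm// [b (v m) r](semi_inner_sym Hb)// bvm// cr big1 => [|j _].
        by rewrite addr0 -[LHS]mul1r -[X in X * _](expr1n _ 2) -cd; ring.
      by rewrite [b r _](semi_inner_sym Hb)// ber// mul0r.
    by apply: eq_bigr => j _; rewrite e'e.
Qed.

Definition span_proj (e : nat -> V) (m : nat) (f : V) : V :=
  \sum_(j < m) b f (e j) *: e j.

Section Projection.
Variables (e : nat -> V) (m : nat).
Hypotheses (He : forall i, H (e i)) (ee : forall i, (i < m)%N -> expands e m (e i)).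

Lemma semi_inner_mem_proj f : H (span_proj e m f).
Proof. by rewrite /span_proj; apply: semi_inner_mem_sum. Qed.

Lemma proj_expands f u : H f -> H u -> expands e m u -> b (f - span_proj e m f) u = 0.
Proof.
move=> Hf Hu eu; rewrite semi_innerBl//; last exact: semi_inner_mem_proj.
rewrite /span_proj semi_inner_suml// (eu _ Hf); apply/eqP; rewrite subr_eq0; apply/eqP.
by apply: eq_bigr => j _; rewrite [b u _](semi_inner_sym Hb).
Qed.

Lemma proj_residual f : H f ->
  b (f - span_proj e m f) (f - span_proj e m f) = b (f - span_proj e m f) f.
Proof.
move=> Hf; have HP := semi_inner_mem_proj f; have Hc := semi_inner_memB Hf HP.
rewrite (semi_innerBl Hf HP Hc) [b (span_proj _ _ _) _]semi_inner_suml// big1 => [|j _].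
  by rewrite subr0 (semi_inner_sym Hb).
rewrite [b (e j) _](semi_inner_sym Hb)// proj_expands ?mulr0//; exact: ee.
Qed.

Lemma bessel f : H f -> \sum_(j < m) b f (e j) ^+ 2 <= b f f.
Proof.
move=> Hf; have HP := semi_inner_mem_proj f; have Hc := semi_inner_memB Hf HP.
have := semi_inner_ge0 Hb Hc; rewrite proj_residual// semi_innerBl// subr_ge0.
rewrite /span_proj semi_inner_suml//; congr (_ <= _).
by apply: eq_bigr => j _; rewrite expr2 [b (e j) f](semi_inner_sym Hb).
Qed.

End Projection.
End SemiInner.

(** * Covering numbers of balls of RKHSs *)

Section Covers.
Context {R : realType}.
Set Implicit Arguments.
Unset Strict Implicit.

Definition covers (E : zmodType) (nrm : E -> R) (A : set E) (eps : R) (m : nat) :=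
  (1 <= m)%N /\ exists x : 'I_m -> E,
    A `<=` \bigcup_(i in [set: 'I_m]) [set f | nrm (f - x i) <= eps].

Lemma lne_covering_number_le (E : zmodType) (nrm : E -> R) (A : set E)
    (eps : R) (m : nat) (c : R) :
  covers nrm A eps m -> ln m%:R <= c ->
  (lne (covering_number nrm A eps) <= c%:E)%E.
Proof.
move=> [m1 cov] mc; apply: (@le_trans _ _ (lne (m%:R)%:E)); last first.
  by rewrite lne_EFin ?ltr0n// lee_fin.
have le0 : (0 <= covering_number nrm A eps)%E.
  by apply: le_ereal_inf_tmp => _ [i _ <-]; rewrite lee_fin ler0n.
rewrite lee_lne; first by apply: ereal_inf_lbound; exists m.
  by rewrite in_itv/= le0 leey.
by rewrite in_itv/= lee_fin ler0n leey.
Qed.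

(** A maximal separated family is a cover. Without a cover of size at most [B], every separated
    family in [A] could be extended, eventually beyond [B] points. *)
Lemma covers_of_packing_bound (E : zmodType) (nrm : E -> R) (A : set E) (eps B : R) :
  A !=set0 -> (forall f, nrm (- f) = nrm f) ->
  (forall N (f : 'I_N -> E), (forall k, A (f k)) ->
     (forall k l, k != l -> eps < nrm (f k - f l)) -> N%:R <= B) ->
  exists2 m, covers nrm A eps m & m%:R <= B.
Proof.
move=> [f0 Af0] nrmN pack.
have [//|nocov] := pselect (exists2 m, covers nrm A eps m & m%:R <= B).
have packings N : exists f : 'I_N -> E, (forall k, A (f k)) /\
    (forall k l, k != l -> eps < nrm (f k - f l)).
  elim: N => [|N [f [Af sepf]]].
    by exists (fun=> f0); split=> // -[].
  have [g [Ag sepg]] : exists g, A g /\ forall k, eps < nrm (g - f k).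
    (* A cover needs at least one centre, so the empty family is extended by [f0]. *)
    have [N0|N0] := posnP N.
      by exists f0; split=> // -[k kN]; exfalso; move: kN; rewrite N0.
    apply: contrapT => nog; apply: nocov; exists N; last exact: (pack N f).
    split=> //; exists f => g Ag; apply: contrapT => gf; apply: nog.
    exists g; split=> // k; rewrite ltNge; apply/negP => le; apply: gf.
    by exists k.
  exists (fun k => if unlift ord_max k is Some k' then f k' else g); split.
    by move=> k; case: unliftP.
  move=> k l; case: unliftP => [k'|] ->; case: unliftP => [l'|] -> //.
  - by rewrite (inj_eq lift_inj) => /sepf.
  - by rewrite -nrmN opprB.
  - by rewrite eqxx.
have [f [Af sepf]] := packings (Num.truncn B).+1.
have := pack _ _ Af sepf; rewrite leNgt => /negP[].
exact: truncnS_gt.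
Qed.

End Covers.

(** * The empirical inner product *)

Section Empirical.
Context {R : realType} {S : Type}.
Set Implicit Arguments.
Unset Strict Implicit.

Definition emp (n : nat) (x : 'I_n -> S) (f g : S -> R) : R :=
  n%:R^-1 * \sum_i f (x i) * g (x i).

Lemma emp_semi_inner (n : nat) (x : 'I_n -> S) : semi_inner setT (emp x).
Proof.
split=> //.
- by move=> f g _ _; rewrite /emp; congr (_ * _); apply: eq_bigr => i _; rewrite mulrC.
- move=> a f g h _ _ _; rewrite /emp mulrCA -mulrDr; congr (_ * _).
  rewrite mulr_sumr -big_split; apply: eq_bigr => i _ /=.
  by rewrite !fctE /= /GRing.scale /=; ring.
- move=> f _; rewrite mulr_ge0 ?invr_ge0// sumr_ge0// => i _.
  by rewrite -expr2 sqr_ge0.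
Qed.

Lemma empirical_L2E (Y : Type) (n : nat) (T : n.-tuple (S * Y)) (f : S -> R) :
  empirical_L2 T f = Num.sqrt (emp (fun i => (tnth T i).1) f f).
Proof.
rewrite /empirical_L2 /emp; congr (Num.sqrt (_ * _)); apply: eq_bigr => i _.
by rewrite real_normK ?num_real// expr2.
Qed.

Lemma empirical_L2N (Y : Type) (n : nat) (T : n.-tuple (S * Y)) (f : S -> R) :
  empirical_L2 T (- f) = empirical_L2 T f.
Proof.
rewrite /empirical_L2; congr (Num.sqrt (_ * _)); apply: eq_bigr => i _.
by rewrite fctE normrN.
Qed.

End Empirical.

(** * Balls of an RKHS on a sample, and the dimension-free bound *)

Section RKHS.
Context {R : realType} {S : Type}.
Set Implicit Arguments.
Unset Strict Implicit.
Variables (k : S -> S -> R) (H : set (S -> R)) (ip : (S -> R) -> (S -> R) -> R).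
Hypotheses (HK : is_RKHS k H ip) (k1 : forall s, k s s <= 1).

Lemma rkhs_semi_inner : semi_inner H ip.
Proof.
case: HK => -[? ? ? ? ? ? ?] _ _; split=> //.
Qed.

Let Hk s : H (fun t => k t s) := rkhs_kernel HK s.

Lemma hilbert_ball_ip f : hilbert_ball H ip f -> ip f f <= 1.
Proof.
move=> [Hf]; rewrite /ip_norm => f1.
by rewrite -[ip f f]sqr_sqrtr ?(semi_inner_ge0 rkhs_semi_inner)// exprn_ile1// sqrtr_ge0.
Qed.

Lemma hilbert_ball0 : hilbert_ball H ip 0.
Proof.
have H0 := semi_inner_zero rkhs_semi_inner; split=> //.
by rewrite /ip_norm (semi_inner0l rkhs_semi_inner)// sqrtr0.
Qed.

(** Reproducing property and Cauchy-Schwarz: f(s)^2 <= <f,f> k(s,s). *)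
Lemma hilbert_ball_sqr_le1 f s : hilbert_ball H ip f -> f s ^+ 2 <= 1.
Proof.
move=> Bf; have Hf := Bf.1; rewrite (rkhs_reproducing HK s Hf).
apply: le_trans (semi_inner_cauchy_schwarz rkhs_semi_inner Hf (Hk s)) _.
rewrite -(rkhs_reproducing HK s (Hk s)).
apply: mulr_ile1; rewrite ?hilbert_ball_ip ?(semi_inner_ge0 rkhs_semi_inner)//.
by rewrite (rkhs_reproducing HK s (Hk s)) (semi_inner_ge0 rkhs_semi_inner).
Qed.

Lemma emp_hilbert_ball n (x : 'I_n -> S) f : hilbert_ball H ip f -> emp x f f <= 1.
Proof.
move=> Bf; rewrite /emp.
have [n0|n0] := posnP n; first by rewrite (_ : n%:R^-1 = 0 :> R) ?mul0r// n0 invr0.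
rewrite ler_pdivrMl ?ltr0n// mulr1 -[n in leRHS]card_ord -sumr_const.
by apply: ler_sum => i _; rewrite -expr2 hilbert_ball_sqr_le1.
Qed.

(** Orthonormalising the kernels at the sample points gives f(x_i) = sum_j <f,e_j> e_j(x_i), so on
    the sample the ball is an ellipsoid. Bessel's inequality for [f l] bounds the coordinates; for
    the kernel at x_i it gives sum_j e_j(x_i)^2 <= 1. With lam = 4/eps the separation eps becomes
    the 16 of [ellipsoid_packing]. *)
Lemma rkhs_packing n (x : 'I_n -> S) N (f : 'I_N -> S -> R) (eps : R) : 0 < eps ->
  (forall l, hilbert_ball H ip (f l)) ->
  (forall l l', l != l' -> eps ^+ 2 < emp x (f l - f l') (f l - f l')) ->
  N%:R <= 2 * expR (16 / eps ^+ 2).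
Proof.
move=> e0 Bf sep; have SI := rkhs_semi_inner.
pose v i : S -> R := if insub i is Some j then fun t => k t (x j) else 0.
have Hv i : H (v i).
  by rewrite /v; case: insubP => // _; exact: (semi_inner_zero SI).
have vE (i : 'I_n) : v i = fun t => k t (x i).
  rewrite /v; case: insubP => [j _ ji|]; last by rewrite ltn_ord.
  by have -> : j = i by exact: val_inj.
have [e [He ee ev]] := gram_schmidt SI n Hv.
have evE (i : 'I_n) f' : H f' -> f' (x i) = \sum_(j < n) ip f' (e j) * e j (x i).
  move=> Hf'; rewrite (rkhs_reproducing HK (x i) Hf') -vE (ev _ (ltn_ord i) _ Hf').
  apply: eq_bigr => j _; congr (_ * _).
  by rewrite vE (semi_inner_sym SI)// -(rkhs_reproducing HK (x i) (He j)).
rewrite (_ : 16 / _ = (4 / eps) ^+ 2); last by field; rewrite gt_eqF.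
apply: (@ellipsoid_packing R n N 'I_n (fun i j => e j (x i)) _ (fun l j => ip (f l) (e j))).
- move=> i; apply: le_trans (k1 (x i)).
  rewrite (rkhs_reproducing HK (x i) (Hk (x i))).
  have := bessel SI He ee (Hk (x i)); congr (_ <= _); apply: eq_bigr => j _.
  by rewrite (semi_inner_sym SI)// -(rkhs_reproducing HK (x i) (He j)).
- move=> l; apply: le_trans (hilbert_ball_ip (Bf l)).
  by have := bessel SI He ee (Bf l).1.
- move=> l l' /sep; rewrite -[_ < _](ltr_pM2l (_ : 0 < (4 / eps) ^+ 2)); last first.
    by rewrite exprn_gt0// divr_gt0.
  rewrite (_ : _ * eps ^+ 2 = 16); last by field; rewrite gt_eqF.
  congr (_ < _ * (_ * _)); apply: eq_bigr => i _.
  rewrite -expr2 !fctE (evE _ _ (Bf l).1) (evE _ _ (Bf l').1); congr (_ ^+ 2).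
  by rewrite -sumrB; apply: eq_bigr => j _; ring.
Qed.

Lemma rkhs_covers_dimension_free (Y : Type) n (T : n.-tuple (S * Y)) (eps : R) : 0 < eps ->
  exists2 m, covers (empirical_L2 T) (hilbert_ball H ip) eps m &
    ln m%:R <= 1 + 16 / eps ^+ 2.
Proof.
move=> e0.
have [|||m cov le] := @covers_of_packing_bound R (S -> R) (empirical_L2 T)
    (hilbert_ball H ip) eps (2 * expR (16 / eps ^+ 2)).
- by exists 0; exact: hilbert_ball0.
- exact: empirical_L2N.
- move=> N f Bf sep; apply: (rkhs_packing (x := fun i => (tnth T i).1) e0 Bf).
  move=> l l' /sep; rewrite empirical_L2E => lt.
  rewrite -[ltRHS]sqr_sqrtr; first by rewrite ltr_sqr// nnegrE ?sqrtr_ge0// ltW.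
  exact: (semi_inner_ge0 (emp_semi_inner _) I).
- exists m => //.
  have m0 : (0 : R) < m%:R by rewrite ltr0n; exact: cov.1.
  rewrite -[leRHS]expRK ler_ln ?posrE ?expR_gt0// (le_trans le)// expRD.
  by rewrite ler_wpM2r ?expR_ge0//; have := expR_ge1Dx (1 : R); lra.
Qed.

(** * Distance from the ball to the span of a kernel approximation *)

Section LowRank.
Variables (J : finType) (phi psi : J -> S -> R) (tau : R).
Hypotheses (tau0 : 0 <= tau)
  (approx : forall s t, `|k s t - \sum_j phi j s * psi j t| <= tau).
Variables (n : nat) (x : 'I_n -> S).

(** Meant for [c] the residual of projecting [f] onto the span of [phi]. Let g in [H] represent the
    functional h -> [emp x c h]. Its squared norm [emp x c g] sees g only modulo that span, where
    the approximation makes it small: |g|^2 <= tau |c|^2. Then |c|^4 = <g,f>^2 <= |g|^2 gives |c|^2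
    <= tau. *)
Lemma rkhs_near_subspace (c f : S -> R) : hilbert_ball H ip f ->
  (forall j, emp x c (phi j) = 0) -> emp x c c = emp x c f -> emp x c c <= tau.
Proof.
move=> Bf orth cf; have SI := rkhs_semi_inner; have SE := @emp_semi_inner R S n x.
have [n0|n0] := posnP n.
  rewrite {1}/emp (_ : n%:R^-1 = 0 :> R) ?mul0r; last by rewrite n0 invr0.
  exact: tau0.
pose g : S -> R := \sum_(i < n) (n%:R^-1 * c (x i)) *: (fun t => k t (x i)).
have Hg : H g by exact: (semi_inner_mem_sum SI).
have cE h : H h -> emp x c h = ip g h.
  move=> Hh; rewrite /g (semi_inner_suml SI)// /emp mulr_sumr; apply: eq_bigr => i _.
  by rewrite (semi_inner_sym SI)// -(rkhs_reproducing HK (x i) Hh) mulrA.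
have c0 : 0 <= emp x c c := semi_inner_ge0 SE (f := c) I.
(* The empirical L1 norm of [c], at most its L2 norm. *)
pose A : R := emp x (fun s => `|c s|) (fun=> 1).
have A2 : A ^+ 2 <= emp x c c.
  apply: le_trans (semi_inner_cauchy_schwarz SE _ _) _ => //.
  rewrite [X in X * _](_ : _ = emp x c c); last first.
    by congr (_ * _); apply: eq_bigr => i _; rewrite -normrM -expr2 ger0_norm ?sqr_ge0.
  rewrite [X in _ * X](_ : _ = 1) ?mulr1// /emp.
  by rewrite mulr1 sumr_const card_ord mulVf// pnatr_eq0 -lt0n.
have gg : ip g g <= tau * A ^+ 2.
  rewrite -cE//.
  pose b a : R := \sum_(j < n) n%:R^-1 * c (x j) * psi a (x j).
  (* [g] with the kernel replaced by its approximation; it lies in the span of [phi], hence is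
     orthogonal to [c]. *)
  pose h : S -> R := \sum_a b a *: phi a.
  have ch : emp x c h = 0.
    rewrite (semi_inner_sym SE)// /h (semi_inner_suml SE)// big1// => a _.
    by rewrite (semi_inner_sym SE)// orth mulr0.
  have gh s : `|(g - h) s| <= A * tau.
    rewrite (_ : (g - h) s = \sum_(j < n) n%:R^-1 * c (x j) *
        (k s (x j) - \sum_a phi a s * psi a (x j))).
      apply: le_trans (ler_norm_sum _ _ _) _.
      rewrite /A /emp mulr_sumr mulr_suml; apply: ler_sum => j _.
      rewrite !normrM mulr1 ger0_norm ?invr_ge0//.
      by apply: ler_wpM2l (approx _ _); rewrite mulr_ge0 ?invr_ge0.
    rewrite !fctE /g /h !fct_sumE.
    under [RHS]eq_bigr do rewrite mulrBr.
    rewrite sumrB; congr (_ - _).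
    rewrite (eq_bigr (fun a => \sum_(j < n) n%:R^-1 * c (x j) * (phi a s * psi a (x j)))).
      by rewrite exchange_big; apply: eq_bigr => j _; rewrite mulr_sumr.
    move=> a _; rewrite /b fctE /GRing.scale /= mulr_suml.
    by apply: eq_bigr => j _; ring.
  rewrite (_ : emp x c g = emp x c (g - h)); last first.
    rewrite [RHS](semi_inner_sym SE)// (semi_innerBl SE)// [emp x h c](semi_inner_sym SE)// ch.
    by rewrite subr0 (semi_inner_sym SE).
  rewrite (_ : tau * A ^+ 2 = A * (A * tau)); last by ring.
  have AE : A = n%:R^-1 * \sum_i `|c (x i)| * 1 by [].
  rewrite {1}AE /emp -mulrA ler_wpM2l ?invr_ge0// mulr_suml.
  apply: ler_sum => i _; rewrite mulr1.
  by apply: le_trans (ler_norm _) _; rewrite normrM ler_wpM2l.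
have gA : ip g g <= tau * emp x c c by apply: le_trans gg _; rewrite ler_wpM2l.
have : emp x c c ^+ 2 <= tau * emp x c c.
  rewrite {1}cf cE ?Bf.1//; last exact: Bf.1.
  apply: le_trans (semi_inner_cauchy_schwarz SI Hg Bf.1) _.
  apply: le_trans gA; rewrite ler_piMr ?hilbert_ball_ip//.
  exact: (semi_inner_ge0 SI).
have [->//|cn0] := eqVneq (emp x c c) 0.
by rewrite expr2 ler_pM2r// lt0r cn0.
Qed.

End LowRank.
End RKHS.

(** * Covers from a finite-rank approximation of the kernel *)

Section FiniteRank.
Context {R : realType} {S : Type}.
Set Implicit Arguments.
Unset Strict Implicit.

Lemma grid_point (t w : R) : 0 < t -> `|w| <= 1 ->
  exists q : 'I_(Num.truncn (2 * t)).+1, `|w - (q%:R / t - 1)| <= t^-1.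
Proof.
move=> t0; rewrite ler_norml => /andP[w1 w2].
pose q := Num.truncn ((w + 1) * t).
have q0 : 0 <= (w + 1) * t by apply: mulr_ge0; [lra|exact: ltW].
have qlt : (q < (Num.truncn (2 * t)).+1)%N.
  by rewrite ltnS; apply: le_truncn; rewrite ler_pM2r//; lra.
exists (Ordinal qlt) => /=.
have /andP[qle ltq] := truncn_itv q0.
rewrite -/q in qle ltq.
have -> : w - (q%:R / t - 1) = ((w + 1) * t - q%:R) / t by field; rewrite gt_eqF.
rewrite normrM normfV (gtr0_norm t0) ler_pdivrMr// mulVf ?gt_eqF//.
by rewrite ler_norml; apply/andP; split; move: ltq; rewrite -natr1; lra.
Qed.

Variables (k : S -> S -> R) (H : set (S -> R)) (ip : (S -> R) -> (S -> R) -> R).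
Hypotheses (HK : is_RKHS k H ip) (k1 : forall s, k s s <= 1).
Variables (J : finType) (phi psi : J -> S -> R) (eps : R).
Hypotheses (eps0 : 0 < eps) (eps1 : eps <= 1).
Hypothesis approx : forall s t, `|k s t - \sum_j phi j s * psi j t| <= eps ^+ 2 / 4.

(** The centres have grid coordinates in an orthonormalisation of [phi] in L_2(T_X). The error
    splits as [c + r], projection residual plus rounding error, each of squared norm at most
    eps^2/4. *)
Lemma rkhs_covers_finite_rank (Y : Type) n (T : n.-tuple (S * Y)) :
  exists2 m, covers (empirical_L2 T) (hilbert_ball H ip) eps m &
    ln m%:R <= #|J|%:R * ln (5 * (#|J|%:R + 1) / eps).
Proof.
pose x i := (tnth T i).1; have SE := @emp_semi_inner R S n x.
pose N := #|J|.
pose v i : S -> R := if insub i is Some j then phi (enum_val (j : 'I_#|J|)) else 0.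
have vE j : v (enum_rank j) = phi j.
  rewrite /v; case: insubP => [i _ ij|]; last by rewrite ltn_ord.
  by have -> : i = enum_rank j; [exact: val_inj|rewrite enum_rankK].
have [e [He ee ev]] := gram_schmidt SE N (v := v) (fun=> I).
(* Rounding N coordinates with error 1/t gives [r] norm at most N/t <= eps/2; the summand 1 keeps
   [t] positive when N = 0. *)
pose t : R := 2 * (N%:R + 1) / eps.
have N0 : 0 <= N%:R :> R by exact: ler0n.
have t0 : 0 < t by rewrite divr_gt0// mulr_gt0//; lra.
pose K := (Num.truncn (2 * t)).+1.
pose center (q : {ffun 'I_N -> 'I_K}) : S -> R :=
  \sum_(j < N) ((q j)%:R / t - 1) *: e j.
exists #|{ffun 'I_N -> 'I_K}|; first split.
- by rewrite card_ffun !card_ord expn_gt0.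
- exists (fun i => center (enum_val i)) => f Bf.
  pose w j := emp x f (e j).
  have w1 (j : 'I_N) : `|w j| <= 1.
    rewrite -[leRHS](expr1n _ 1) -sqrtr1 -sqrtr_sqr ler_wsqrtr//.
    apply: le_trans (emp_hilbert_ball HK k1 x Bf).
    apply: le_trans (bessel SE He ee (f := f) I).
    by rewrite (bigD1 j)//= lerDl sumr_ge0// => i _; rewrite sqr_ge0.
  have /choice[q qw] (j : 'I_N) := grid_point t0 (w1 j).
  exists (enum_rank [ffun j => q j]) => //=.
  rewrite enum_rankK empirical_L2E -/x.
  set c := f - span_proj (emp x) e N f.
  have cc : emp x c c <= eps ^+ 2 / 4.
    apply: (rkhs_near_subspace HK _ approx Bf).
    + by rewrite divr_ge0 ?sqr_ge0.
    + move=> j; rewrite -(vE j); apply: (proj_expands SE He) => //.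
      exact: ev.
    + exact: (proj_residual SE He ee).
  pose z (j : 'I_N) := w j - ((q j)%:R / t - 1).
  set r : S -> R := \sum_(j < N) z j *: e j.
  have ejk (i j : 'I_N) : `|emp x (e i) (e j)| <= 1.
    (* Bessel's inequality for [e l] itself says a^2 <= a for its squared norm a. *)
    have e1 (l : 'I_N) : emp x (e l) (e l) <= 1.
      have := bessel SE He ee (f := e l) I.
      rewrite (bigD1 l)//= => /(le_trans _) h.
      have {}h : emp x (e l) (e l) ^+ 2 <= emp x (e l) (e l).
        by apply: h; rewrite lerDl sumr_ge0// => a _; rewrite sqr_ge0.
      by have := semi_inner_ge0 SE (f := e l) I; nra.
    rewrite -[leRHS]sqrtr1 -sqrtr_sqr ler_wsqrtr//.
    apply: le_trans (semi_inner_cauchy_schwarz SE I I) _.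
    by apply: mulr_ile1; rewrite ?(semi_inner_ge0 SE I).
  have rr : emp x r r <= eps ^+ 2 / 4.
    rewrite /r (semi_inner_suml SE)//.
    apply: (@le_trans _ _ (\sum_(i < N) \sum_(j < N) t^-1 * t^-1)).
      apply: ler_sum => i _; rewrite (semi_inner_sym SE)// (semi_inner_suml SE)// mulr_sumr.
      apply: ler_sum => j _; apply: le_trans (ler_norm _) _.
      rewrite (normrM (z i)) (normrM (z j)); apply: ler_pM; rewrite ?mulr_ge0//; first exact: (qw i).
      by rewrite -[leRHS]mulr1; apply: ler_pM => //; exact: (qw j).
    have Nt : N%:R / t <= eps / 2.
      rewrite ler_pdivrMr// /t (_ : eps / 2 * _ = N%:R + 1); last by field; rewrite gt_eqF.
      by lra.
    rewrite !sumr_const card_ord -mulrnA -[leLHS]mulr_natl natrM mulrACA.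
    rewrite (_ : eps ^+ 2 / 4 = (eps / 2) * (eps / 2)); last by field.
    by rewrite ler_pM ?divr_ge0// ltW.
  rewrite (_ : f - _ = c + r); last first.
    rewrite /c /r /center /span_proj -addrA; congr (_ + _).
    rewrite -!sumrN -big_split /=; apply: eq_bigr => j _.
    by rewrite ffunE /z [X in _ = _ + X]scalerBl addKr.
  rewrite -[leRHS](ger0_norm (ltW eps0)) -sqrtr_sqr ler_wsqrtr//.
  have := semi_inner_sqrD_le SE (f := c) (g := r) I I.
  by move=> h; lra.
rewrite card_ffun !card_ord natrX lnXn ?ltr0n// -[leLHS]mulr_natl -/N.
have N1 : 1 <= (N%:R + 1) / eps
  by rewrite ler_pdivlMr// mul1r (le_trans eps1)// lerDr.
have NE : 5 * (N%:R + 1) / eps = 5 * ((N%:R + 1) / eps) by rewrite mulrA.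
rewrite ler_wpM2l// ler_ln ?posrE ?ltr0n//; last by rewrite NE; lra.
have le2t : (Num.truncn (2 * t))%:R <= 2 * t by rewrite truncn_le mulr_ge0// ltW.
(* K <= 2t + 1 = 4(N+1)/eps + 1 <= 5(N+1)/eps. *)
rewrite /K -natr1 NE; apply: le_trans (lerD le2t (lexx 1)) _.
by rewrite (_ : t = 2 * ((N%:R + 1) / eps)) ?mulrA//; lra.
Qed.

End FiniteRank.

(** * Low-rank approximation of the Gaussian kernel *)

Section ExpTaylor.
Set Implicit Arguments.
Unset Strict Implicit.
Context {R : realType}.
Implicit Types x : R.

Lemma expR_partial_sum_le x n : 0 <= x -> \sum_(i < n) x ^+ i / i`!%:R <= expR x.
Proof.
move=> x0; have := nondecreasing_cvgn_le _ (is_cvg_series_exp_coeff x) n.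
rewrite /series /= big_mkord; apply.
apply: nondecreasing_series => i _ _; exact: exp_coeff_ge0.
Qed.

Lemma expR_term_le x n : 0 <= x -> x ^+ n / n`!%:R <= expR x.
Proof.
move=> x0; apply: le_trans (expR_partial_sum_le n.+1 x0).
rewrite big_ord_recr /= lerDr sumr_ge0// => i _.
by rewrite divr_ge0 ?exprn_ge0.
Qed.

(** As M! i! <= (M+i)!, each tail term is at most |x|^M/M! times |x|^i/i!; the bound on partial sums
    passes to the limit. *)
Lemma expR_taylor_remainder x M :
  `|expR x - \sum_(i < M) x ^+ i / i`!%:R| <= `|x| ^+ M / M`!%:R * expR `|x|.
Proof.
set B := leRHS.
have part N : `|\sum_(i < M + N) x ^+ i / i`!%:R - \sum_(i < M) x ^+ i / i`!%:R| <= B.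
  rewrite big_split_ord /= addrAC subrr add0r.
  apply: le_trans (ler_norm_sum _ _ _) _.
  apply: (@le_trans _ _ (\sum_(i < N) `|x| ^+ M / M`!%:R * (`|x| ^+ i / i`!%:R))).
    apply: ler_sum => i _.
    rewrite normrM normfV normrX normr_nat exprD mulrACA ler_wpM2l ?mulr_ge0 ?exprn_ge0//.
    rewrite -invfM lef_pV2 ?posrE -?natrM ?ltr0n ?muln_gt0 ?fact_gt0// ler_nat.
    rewrite -(bin_fact (leq_addr i M)) addKn leq_pmull// bin_gt0 leq_addr.
    done.
  by rewrite -mulr_sumr ler_wpM2l ?expR_partial_sum_le// divr_ge0 ?exprn_ge0.
have cv : (fun N => `|series (exp_coeff x) (N + M)%N - \sum_(i < M) x ^+ i / i`!%:R|) @ \oo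
   --> `|expR x - \sum_(i < M) x ^+ i / i`!%:R|.
  apply: cvg_norm; apply: cvgB; last exact: cvg_cst.
  by rewrite cvg_shiftn; exact: is_cvg_series_exp_coeff.
have : limn (fun N => `|series (exp_coeff x) (N + M)%N - \sum_(i < M) x ^+ i / i`!%:R|) <= B.
  apply: limr_le; first by apply/cvg_ex; eexists; exact: cv.
  by apply: nearW => N; rewrite /series /= big_mkord addnC part.
by rewrite (cvg_lim _ cv).
Qed.

End ExpTaylor.

(** * The one-dimensional Gaussian near the centre of a cell *)

Section GaussLowRank.
Set Implicit Arguments.
Unset Strict Implicit.
Context {R : realType}.

Lemma expR_half_le2 : expR 2^-1 <= 2 :> R.
Proof.
rewrite -[leLHS]invrK -expRN -[leRHS]invrK lef_pV2 ?posrE ?expR_gt0 ?invr_gt0//.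
by apply: le_trans (expR_ge1Dx _); lra.
Qed.

(* With u the distance from the centre of a cell to t and h that from the
   centre to s, both in units of 1 / sigma, the growth of u ^+ M is absorbed by
   half of the Gaussian expR (- u ^+ 2), since (u ^+ 2) ^+ M / M`! <= expR (u ^+ 2). *)
Lemma gauss_taylor (u h : R) (M : nat) : `|h| <= 8^-1 ->
  `|expR (- (u + h) ^+ 2) -
    expR (- h ^+ 2) * expR (- u ^+ 2) * \sum_(i < M) (- (2 * u * h)) ^+ i / i`!%:R|
  <= 2 * expR (- M%:R).
Proof.
move=> h8; set y := - (2 * u * h).
(* Only the factor mixing [u] and [h] is expanded. *)
have -> : expR (- (u + h) ^+ 2) = expR (- h ^+ 2) * expR (- u ^+ 2) * expR y.
  by rewrite -!expRD; congr expR; rewrite /y; ring.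
rewrite -mulrBr normrM ger0_norm ?mulr_ge0 ?expR_ge0//.
apply: le_trans (ler_wpM2l _ (expR_taylor_remainder y M)) _.
  by rewrite mulr_ge0 ?expR_ge0.
have yE : `|y| = `|u| * (2 * `|h|) by rewrite /y normrN !normrM (ger0_norm (_ : 0 <= 2))//; ring.
have fM : 0 < (M`!%:R : R) by rewrite ltr0n fact_gt0.
(* After squaring: (u^2)^M / (M!)^2 <= (u^2)^M / M! <= exp(u^2). *)
have uM : `|u| ^+ M / M`!%:R <= expR (u ^+ 2 / 2).
  rewrite -ler_sqr ?nnegrE ?divr_ge0 ?exprn_ge0 ?expR_ge0//.
  rewrite -expRM_natl (_ : 2%:R * _ = u ^+ 2); last by field.
  apply: le_trans (expR_term_le M (sqr_ge0 u)).
  rewrite expr_div_n -exprM mulnC exprM real_normK ?num_real// ler_wpM2l//.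
    by apply: exprn_ge0; exact: sqr_ge0.
  by rewrite lef_pV2 ?posrE ?exprn_gt0// ler_eXnr// ler1n fact_gt0.
(* 2|h| <= 1/4 <= exp(-1). *)
have hM : (2 * `|h|) ^+ M <= expR (- M%:R).
  rewrite -mulrN1 expRM_natl; apply: lerXn2r; rewrite ?nnegrE ?mulr_ge0 ?expR_ge0//.
  rewrite expRN -[leRHS]mul1r ler_pdivlMr ?expR_gt0//.
  have e4 : expR 1 <= (4 : R).
    rewrite [X in expR X](_ : 1 = 2%:R * 2^-1); last by field.
    rewrite expRM_natl (_ : 4 = 2 ^+ 2 :> R); last by ring.
    by rewrite lerXn2r ?nnegrE ?expR_ge0// expR_half_le2.
  have := normr_ge0 h; have := expR_gt0 (1 : R) => p q; nra.
rewrite yE exprMn; set a := `|u| ^+ M in uM *; set c := (_ * _) ^+ M in hM *.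
set E := expR (_ * _); set G := expR _ * expR _.
rewrite (_ : G * _ = G * E * (a / M`!%:R) * c); last by ring.
apply: ler_pM => //; rewrite ?mulr_ge0 ?expR_ge0 ?invr_ge0 ?exprn_ge0 ?mulr_ge0//.
apply: (@le_trans _ _ (G * E * expR (u ^+ 2 / 2))).
  by rewrite ler_wpM2l// !mulr_ge0 ?expR_ge0.
rewrite /G /E -!expRD.
(* The remaining exponent -h^2 - u^2/2 + 2|u||h| is at most 1/2 because |h| <= 1/8. *)
apply: (@le_trans _ _ (expR 2^-1)).
  rewrite ler_expR.
  rewrite -(real_normK (num_real u)) -(real_normK (num_real h)).
  have := normr_ge0 h; have := normr_ge0 u => *; nra.
exact: expR_half_le2.
Qed.

End GaussLowRank.

(** * Cells of an interval and products over the coordinates *)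

Section GaussLowRankD.
Context {R : realType}.
Set Implicit Arguments.
Unset Strict Implicit.

(* The interval [-A, A] is cut into cells of length 1 / (4 sigma), with centres
   cell_center; the features are monomials on the cells. *)
Definition cell (sigma A s : R) : nat := Num.truncn ((s + A) * (4 * sigma)).

Definition cell_center (sigma A : R) (l : nat) : R := (l%:R + 2^-1) / (4 * sigma) - A.

Definition ncells (sigma A : R) : nat := (Num.truncn (8 * A * sigma)).+1.

Definition gauss_phi (sigma A : R) (l m : nat) (s : R) : R :=
  let h := sigma * (s - cell_center sigma A l) in
  (cell sigma A s == l)%:R * (expR (- h ^+ 2) * h ^+ m).

Definition gauss_psi (sigma A : R) (l m : nat) (t : R) : R :=
  let u := sigma * (cell_center sigma A l - t) in
  expR (- u ^+ 2) * (- (2 * u)) ^+ m / m`!%:R.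

(** Only the cell of [s] contributes, and [s] is within half a cell length, 1/(8 sigma), of its
    centre, so [gauss_taylor] applies. Writing (-2uh)^m = (-2u)^m h^m separates the variables. *)
Lemma gauss_low_rank1 (sigma A s t : R) (M : nat) : 0 < sigma -> `|s| <= A ->
  `|expR (- (sigma ^+ 2 * (s - t) ^+ 2)) -
    \sum_(lm : 'I_(ncells sigma A) * 'I_M)
       gauss_phi sigma A lm.1 lm.2 s * gauss_psi sigma A lm.1 lm.2 t|
  <= 2 * expR (- M%:R).
Proof.
move=> sg0; rewrite ler_norml => /andP[s1 s2].
have a0 : 0 <= (s + A) * (4 * sigma) by apply: mulr_ge0; [lra|rewrite mulr_ge0// ltW].
have lt : (cell sigma A s < ncells sigma A)%N.
  rewrite /cell /ncells ltnS; apply: le_truncn.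
  by rewrite mulrA ler_pM2r//; lra.
set l := cell sigma A s in lt.
pose h := sigma * (s - cell_center sigma A l).
pose u := sigma * (cell_center sigma A l - t).
have h8 : `|h| <= 8^-1.
  have /andP[le1 lt1] := truncn_itv a0.
  rewrite -/(cell sigma A s) -/l -natr1 in le1 lt1.
  rewrite (_ : h = ((s + A) * (4 * sigma) - l%:R - 2^-1) / 4); last first.
    by rewrite /h /cell_center; field; rewrite gt_eqF.
  by rewrite ler_norml; apply/andP; split; lra.
have := gauss_taylor u M h8; congr (`| _ - _ | <= _).
  by congr expR; rewrite /h /u; ring.
rewrite -(pair_bigA _ (fun (l : 'I_(ncells sigma A)) (m : 'I_M) =>
  gauss_phi sigma A l m s * gauss_psi sigma A l m t)) /=.
rewrite (bigD1 (Ordinal lt))//= [X in _ = _ + X]big1 ?addr0 => [|l' l'l]; last first.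
  apply: big1 => m _; rewrite /gauss_phi (_ : cell sigma A s == l' = false) ?mul0r//.
  by apply/negbTE; apply: contra l'l => /eqP ll'; apply/eqP/val_inj.
rewrite mulr_sumr; apply: eq_bigr => m _.
rewrite /gauss_phi /gauss_psi -/l eqxx mul1r -/h -/u.
by rewrite (_ : - (2 * u * h) = (- (2 * u)) * h) ?exprMn; ring.
Qed.

Lemma prodr_close (d : nat) (a b : 'I_d -> R) (eta : R) : eta <= 1 ->
  (forall i, 0 <= a i <= 1) -> (forall i, `|a i - b i| <= eta) ->
  `|\prod_i a i - \prod_i b i| <= d%:R * 2 ^+ d * eta.
Proof.
move=> eta1 a01 ab.
(* The factors are exchanged one at a time, so the induction also carries the bound from |b_i| <= 1
   + eta <= 2. *)
suff: `|\prod_i b i| <= 2 ^+ d /\ `|\prod_i a i - \prod_i b i| <= d%:R * 2 ^+ d * eta by case.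
elim: d a b a01 ab => [|d IH] a b a01 ab.
  by rewrite !big_ord0 subrr normr0 normr1 expr0 !mul0r.
have [IH1 IH2] := IH (fun i => a (lift ord0 i)) (fun i => b (lift ord0 i))
  (fun=> a01 _) (fun=> ab _).
have eta0 : 0 <= eta by apply: le_trans (ab ord0).
have /andP[a0 a1] := a01 ord0; have := ab ord0.
have b2 : `|b ord0| <= 2.
  by move: (ab ord0); rewrite !ler_norml => /andP[? ?]; apply/andP; split; lra.
rewrite !big_ord_recl; set P := \prod_i a _ in IH2 *; set Q := \prod_i b _ in IH1 IH2 *.
move=> ab0; split; first by rewrite normrM exprS ler_pM.
rewrite (_ : _ - _ = a ord0 * (P - Q) + (a ord0 - b ord0) * Q); last by ring.
apply: le_trans (ler_normD _ _) _; rewrite !normrM (ger0_norm a0).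
apply: (@le_trans _ _ (1 * (d%:R * 2 ^+ d * eta) + eta * 2 ^+ d)).
  by apply: lerD; apply: ler_pM.
rewrite mul1r -natr1 exprS.
have : 0 <= 2 ^+ d * eta by rewrite mulr_ge0 ?exprn_ge0.
have : 0 <= d%:R * (2 ^+ d * eta) by rewrite !mulr_ge0 ?exprn_ge0.
by lra.
Qed.

Lemma gauss_kernelE (d : nat) (X : set 'rV[R]_d) (sigma : R) (x y : X) :
  gauss_kernel sigma x y =
  \prod_(i < d) expR (- (sigma ^+ 2 * (val x ord0 i - val y ord0 i) ^+ 2)).
Proof.
rewrite /gauss_kernel /l2norm sqr_sqrtr; last by apply: sumr_ge0 => i _; rewrite sqr_ge0.
rewrite -expR_sum mulr_sumr -sumrN; congr expR; apply: eq_bigr => i _.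
by rewrite real_normK ?num_real// !mxE.
Qed.

(** Expanding the product of the d one-dimensional sums gives one term per choice of a cell and a
    degree in each coordinate: rank ([ncells sigma A] M)^d. *)
Lemma gauss_low_rank (d : nat) (X : set 'rV[R]_d) (A sigma eta : R) (M : nat) :
  0 < sigma -> (forall (x : X) i, `|val x ord0 i| <= A) ->
  2 * expR (- M%:R) <= 1 :> R -> d%:R * 2 ^+ d * (2 * expR (- M%:R)) <= eta ->
  exists (phi psi : {ffun 'I_d -> 'I_(ncells sigma A) * 'I_M} -> X -> R),
    forall x y, `|gauss_kernel sigma x y - \sum_j phi j x * psi j y| <= eta.
Proof.
move=> sg0 XA M1 Me.
exists (fun (j : {ffun 'I_d -> 'I_(ncells sigma A) * 'I_M}) (x : X) =>
  \prod_i gauss_phi sigma A (j i).1 (j i).2 (val x ord0 i)).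
exists (fun (j : {ffun 'I_d -> 'I_(ncells sigma A) * 'I_M}) (x : X) =>
  \prod_i gauss_psi sigma A (j i).1 (j i).2 (val x ord0 i)).
move=> x y; rewrite gauss_kernelE.
under [X in _ - X]eq_bigr do rewrite -big_split /=.
rewrite -(bigA_distr_bigA (fun (i : 'I_d) (lm : 'I_(ncells sigma A) * 'I_M) =>
   gauss_phi sigma A lm.1 lm.2 (val x ord0 i) *
   gauss_psi sigma A lm.1 lm.2 (val y ord0 i))).
apply: le_trans Me; apply: prodr_close => // i.
  rewrite expR_ge0 expR_le1 oppr_le0 mulr_ge0 ?sqr_ge0//.
exact: gauss_low_rank1.
Qed.

End GaussLowRankD.

(** * Covering numbers of Gaussian RKHS balls *)

Section PowerBounds.
Context {R : realType}.
Set Implicit Arguments.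
Unset Strict Implicit.
Implicit Types x kappa : R.

Lemma powR_ge1 x kappa : 1 <= x -> 0 <= kappa -> 1 <= x `^ kappa.
Proof. by move=> x1 k0; rewrite -(powRr0 x) ler_powR. Qed.

(** ln y <= y - 1 at y = x^kappa; it trades logarithms for arbitrarily small powers. *)
Lemma ln_le_powR x kappa : 0 < x -> 0 < kappa -> ln x <= kappa^-1 * x `^ kappa.
Proof.
move=> x0 k0; rewrite ler_pdivlMl// -ln_powR.
have p0 : 0 < x `^ kappa by rewrite powR_gt0.
have := @le_ln1Dx _ (x `^ kappa - 1); rewrite addrCA subrr addr0 => h.
by apply: le_trans (h _) _; lra.
Qed.

(** A weighted geometric mean is at least the smaller of [a] and [b]. *)
Lemma interpolation_le (a b m theta : R) : 0 < a -> 0 < b -> m <= a -> m <= b ->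
  0 <= theta -> theta <= 1 -> m <= a `^ theta * b `^ (1 - theta).
Proof.
move=> a0 b0 ma mb t0 t1.
wlog ab : a b theta a0 b0 ma mb t0 t1 / a <= b.
  move=> W; have [/W|/ltW ba] := leP a b; first exact.
  by rewrite mulrC -{2}[theta](subKr 1) W//; lra.
apply: le_trans ma _.
have {1}-> : a = a `^ theta * a `^ (1 - theta).
  rewrite -powRD; last by rewrite (gt_eqF a0) implybT.
  by rewrite (_ : theta + (1 - theta) = 1) ?powRr1 ?(ltW a0)//; ring.
rewrite ler_wpM2l ?powR_ge0//.
by apply: ge0_ler_powR; rewrite ?nnegrE ?(ltW a0) ?(ltW b0)//; lra.
Qed.

End PowerBounds.

(** * The bound with an arbitrarily small power of 1/eps *)

Section GaussCovers.
Context {R : realType}.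
Set Implicit Arguments.
Unset Strict Implicit.

Lemma gauss_kernel_diag (d : nat) (X : set 'rV[R]_d) (sigma : R) (x : X) :
  gauss_kernel sigma x x <= 1.
Proof. by rewrite /gauss_kernel expR_le1 oppr_le0 mulr_ge0 ?sqr_ge0. Qed.

Lemma ncells_le (sigma A : R) : 1 <= sigma -> 0 <= A ->
  (ncells sigma A)%:R <= (8 * A + 1) * sigma.
Proof.
move=> s1 A0; rewrite /ncells -natr1.
have : (Num.truncn (8 * A * sigma))%:R <= 8 * A * sigma.
  by rewrite truncn_le !mulr_ge0//; lra.
by lra.
Qed.

Lemma taylor_order (d : nat) (kappa : R) : 0 < kappa ->
  exists2 C : R, 1 <= C & forall eps : R, 0 < eps -> eps <= 1 ->
  exists M : nat, [/\ M%:R <= C * eps `^ (- kappa), 2 * expR (- M%:R) <= 1 :> R &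
    d%:R * 2 ^+ d * (2 * expR (- M%:R)) <= eps ^+ 2 / 4].
Proof.
(* M will give D exp(-M) <= eps^2: the part 8 d 2^d of [D] yields the last bound, the part 2 yields
   2 exp(-M) <= 1. *)
move=> k0; pose D : R := d%:R * 2 ^+ d * 8 + 2.
have D0 : 0 <= d%:R * 2 ^+ d * 8 :> R by rewrite !mulr_ge0 ?exprn_ge0.
have lnD : 0 <= ln D by rewrite ln_ge0// /D; lra.
have ki : 0 < kappa^-1 by rewrite invr_gt0.
(* The 1 pays for rounding M up, as eps^(-kappa) >= 1. *)
exists (ln D + 2 * kappa^-1 + 1); first by lra.
move=> eps e0 e1; have ep1 : 1 <= eps `^ (- kappa).
  rewrite powRN -[leLHS]invr1 lef_pV2 ?posrE ?powR_gt0// -(powRr0 eps).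
  by rewrite ger_powR ?e0// ltW.
have De : 0 < D / eps ^+ 2 by rewrite divr_gt0 ?exprn_gt0// /D; lra.
have e21 : eps ^+ 2 <= 1 by rewrite exprn_ile1// ltW.
have lnDe : ln (D / eps ^+ 2) <= (ln D + 2 * kappa^-1) * eps `^ (- kappa).
  rewrite lnM ?posrE ?invr_gt0 ?exprn_gt0//; last by rewrite /D; lra.
  rewrite -exprVn lnXn ?invr_gt0// -[ln _ *+ 2]mulr_natl [leRHS]mulrDl; apply: lerD.
    by rewrite ler_peMr.
  rewrite -mulrA ler_wpM2l//.
  rewrite (_ : eps `^ (- kappa) = eps^-1 `^ kappa).
    by apply: ln_le_powR; rewrite ?invr_gt0.
  by rewrite -[eps^-1]powR_inv1 ?(ltW e0)// -powRrM mulN1r.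
have De1 : 1 <= D / eps ^+ 2.
  by rewrite ler_pdivlMr ?exprn_gt0// mul1r /D; lra.
exists (Num.truncn (ln (D / eps ^+ 2))).+1; set M := _.+1.
have MD : expR (- M%:R) <= eps ^+ 2 / D.
  rewrite expRN -[leRHS]invrK invf_div lef_pV2 ?posrE ?expR_gt0//.
  by rewrite -[leLHS]lnK ?posrE// ler_expR ltW// truncnS_gt.
have E0 : 0 < expR (- M%:R) :> R := expR_gt0 _.
have {}MD : D * expR (- M%:R) <= eps ^+ 2.
  by move: MD; rewrite ler_pdivlMr 1?mulrC// /D; lra.
split.
- rewrite /M -natr1.
  have : (Num.truncn (ln (D / eps ^+ 2)))%:R <= ln (D / eps ^+ 2).
    by rewrite truncn_le ln_ge0.
  by move=> h; rewrite [leRHS]mulrDl mul1r lerD// (le_trans h).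
- have : 0 <= d%:R * 2 ^+ d * 8 * expR (- M%:R) :> R by rewrite mulr_ge0// ltW.
  by move: MD; rewrite /D; lra.
- by move: MD; rewrite /D; lra.
Qed.

(** The rank satisfies r <= B^d sigma^d eps^(-kappa d), and the logarithm in
    [rkhs_covers_finite_rank] is bounded by a multiple of the power kappa of its argument, which
    adds kappa d to the exponent of sigma. *)
Lemma gauss_covers_exp_rate (d : nat) (X : set 'rV[R]_d) (A kappa : R) :
  0 <= A -> (forall (x : X) i, `|val x ord0 i| <= A) -> 0 < kappa -> kappa <= 1 ->
  exists2 C : R, 0 < C &
  forall sigma (H : set (X -> R)) (ip : (X -> R) -> (X -> R) -> R) eps,
  1 <= sigma -> is_RKHS (gauss_kernel (X := X) sigma) H ip -> 0 < eps -> eps <= 1 ->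
  forall n (T : n.-tuple (X * labels R)),
  exists2 m, covers (empirical_L2 T) (hilbert_ball H ip) eps m &
    ln m%:R <= C * sigma `^ ((1 + kappa) * d%:R) * eps `^ (- (kappa * (2 * d%:R + 1))).
Proof.
move=> A0 XA k0 k1; have [C0 C01 HC] := taylor_order d k0.
pose B : R := (8 * A + 1) * C0.
have B1 : 1 <= B by rewrite /B -[leLHS]mulr1 ler_pM//; lra.
have B0 : 0 <= B by lra.
(* 10 = 5 * 2, from r + 1 <= 2 B^d P. *)
pose C : R := B ^+ d * (kappa^-1 * (10 * B ^+ d) `^ kappa).
have Bd : 1 <= B ^+ d by rewrite exprn_ege1.
have ki : 0 < kappa^-1 by rewrite invr_gt0.
have C_gt0 : 0 < C.
  by rewrite /C mulr_gt0 ?mulr_gt0 ?powR_gt0//; lra.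
exists C => // sigma H ip eps s1 HK e0 e1 n T.
have [M [M1 M2 M3]] := HC _ e0 e1.
have s0 : 0 < sigma by lra.
have [phi [psi approx]] := gauss_low_rank s0 XA M2 M3.
have [m cov lnm] := rkhs_covers_finite_rank HK (@gauss_kernel_diag d X sigma) e0 e1 approx T.
exists m => //; apply: le_trans lnm _.
set r := #|_|.
pose P := sigma `^ d%:R * eps `^ (- (kappa * d%:R)).
have e_ge1 a : 0 <= a -> 1 <= eps `^ (- a).
  move=> a0; rewrite powRN -[leLHS]invr1 lef_pV2 ?posrE ?powR_gt0// -(powRr0 eps).
  by rewrite ger_powR ?e0.
have P1 : 1 <= P.
  rewrite /P -[leLHS]mulr1; apply: ler_pM => //; first exact: powR_ge1.
  by apply: e_ge1; rewrite mulr_ge0// ltW.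
have rP : r%:R <= B ^+ d * P.
  rewrite /r card_ffun card_prod !card_ord natrX natrM.
  rewrite (_ : B ^+ d * P = (B * (sigma * eps `^ (- kappa))) ^+ d); last first.
    rewrite !exprMn -(powR_mulrn d (ltW s0)).
    by rewrite -(powR_mulrn d (powR_ge0 eps _)) -powRrM mulNr.
  rewrite (_ : B * _ = ((8 * A + 1) * sigma) * (C0 * eps `^ (- kappa))); last first.
    by rewrite /B; ring.
  have le : (ncells sigma A)%:R * M%:R <= (8 * A + 1) * sigma * (C0 * eps `^ (- kappa)).
    by rewrite ler_pM// ncells_le.
  by apply: lerXn2r => //; rewrite nnegrE;
    [exact: mulr_ge0|apply: le_trans le; exact: mulr_ge0].
have r0 : 0 <= r%:R :> R by [].
have BP1 : 1 <= B ^+ d * P by rewrite -[leLHS]mulr1 ler_pM.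
have lnr : ln (5 * (r%:R + 1) / eps) <=
    kappa^-1 * ((10 * B ^+ d) `^ kappa * P `^ kappa * eps `^ (- kappa)).
  have pos : 0 < 5 * (r%:R + 1) / eps by rewrite divr_gt0//; lra.
  apply: le_trans (ln_le_powR pos k0) _; rewrite ler_wpM2l ?(ltW ki)//.
  have Bd0 : 0 <= 10 * B ^+ d by lra.
  have ei0 : 0 <= eps^-1 by rewrite invr_ge0 ltW.
  rewrite (_ : eps `^ (- kappa) = eps^-1 `^ kappa); last first.
    by rewrite -[eps^-1]powR_inv1 ?(ltW e0)// -powRrM mulN1r.
  rewrite -(powRM _ Bd0) ?(le_trans ler01)// -powRM//; last first.
    by rewrite mulr_ge0// (le_trans ler01).
  apply: ge0_ler_powR; rewrite ?nnegrE ?(ltW k0) ?(ltW pos)//.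
    by apply: mulr_ge0 => //; apply: mulr_ge0 => //; exact: le_trans P1.
  by rewrite ler_wpM2r//; lra.
apply: le_trans (ler_pM r0 _ rP lnr) _.
  by rewrite ln_ge0// ler_pdivlMr// mul1r; lra.
rewrite (_ : (1 + kappa) * d%:R = d%:R + d%:R * kappa); last by ring.
rewrite powRD; last by rewrite (gt_eqF s0) implybT.
have Pk : P `^ kappa = sigma `^ (d%:R * kappa) * eps `^ (- (kappa * d%:R * kappa)).
  by rewrite /P powRM ?powR_ge0// -!powRrM mulNr.
(* kappa d + kappa^2 d + kappa <= kappa (2d + 1), as kappa <= 1. *)
have ebound :
  eps `^ (- (kappa * d%:R)) * eps `^ (- (kappa * d%:R * kappa)) * eps `^ (- kappa)
   <= eps `^ (- (kappa * (2 * d%:R + 1))).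
  rewrite -!powRD; [|by rewrite (gt_eqF e0) implybT|by rewrite (gt_eqF e0) implybT].
  apply: ger_powR; first by rewrite e0.
  have h : 0 <= kappa * d%:R * (1 - kappa).
    by apply: mulr_ge0; [apply: mulr_ge0 => //; exact: ltW|lra].
  by lra.
rewrite Pk /P /C.
set u := B ^+ d; set v := _ `^ kappa; set e' := eps `^ (- (kappa * (2 * d%:R + 1))) in ebound *.
set s' := sigma `^ _; set s'' := sigma `^ _.
set x := eps `^ _ in ebound *; set y := eps `^ _ in ebound *; set z := eps `^ _ in ebound *.
have assoc (a1 a2 a3 a4 a5 a6 a7 a8 : R) :
    a1 * (a2 * a3) * (a4 * (a5 * (a6 * a7) * a8)) =
    a1 * (a4 * a5) * (a2 * a6) * (a3 * a7 * a8) by ring.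
by rewrite assoc ler_wpM2l// !mulr_ge0 ?powR_ge0 ?exprn_ge0// ltW.
Qed.

End GaussCovers.

(** * Interpolation between the two entropy bounds *)

Lemma compact_coordinate_bound (R : realType) (d : nat) (X : set 'rV[R]_d) : compact X ->
  exists2 A : R, 0 <= A & forall (x : X) i, `|val x ord0 i| <= A.
Proof.
move=> /compact_bounded[B [_ HB]]; exists (Num.max 0 (B + 1)).
  by rewrite le_max lexx.
move=> x i; have Bx : B < Num.max 0 (B + 1) by rewrite lt_max ltrDl ltr01 orbT.
apply: le_trans (HB _ Bx _ (set_valP x)).
rewrite [leRHS](mx_normrE (val x)).
exact: (le_bigmax _ (fun ij : 'I_1 * 'I_d => `|val x ij.1 ij.2|) (ord0, i)).
Qed.

Theorem theorem2p1 (R : realType) (d : nat) (X : set 'rV[R]_d) :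
  compact X -> interior X !=set0 ->
  forall p delta : R, 0 < p -> p <= 2 -> 0 < delta ->
  exists c : R, 0 < c /\
    forall sigma : R, 1 <= sigma ->
    forall (H : set (X -> R)) (ip : (X -> R) -> (X -> R) -> R),
    is_RKHS (gauss_kernel (X := X) sigma) H ip ->
    forall (n : nat) (eps : R), (1 <= n)%N -> 0 < eps ->
    (ereal_sup [set lne (covering_number (empirical_L2 T)
                           (hilbert_ball H ip) eps)
               | T in [set: n.-tuple (X * labels R)]]
     <= (c * sigma `^ ((1 - p / 2) * (1 + delta) * d%:R)
           * eps `^ (- p))%:E)%E.
Proof.
move=> cX _ p delta p0 p2 d0.
have [A A0 XA] := compact_coordinate_bound cX.
(* [a <= 1] makes kappa = a/q at most 1, [a <= p] makes theta <= 1, and the last bound says 1 + a <=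
   (1 - a/2)(1 + delta), for the exponent of sigma. *)
pose a := Num.min 1 (Num.min p (2 * delta / (3 + delta))).
have a0 : 0 < a by rewrite !lt_min ltr01 p0 divr_gt0//; lra.
have a1 : a <= 1 by rewrite ge_min lexx.
have ap : a <= p by rewrite !ge_min lexx orbT.
have ad : a * (3 + delta) <= 2 * delta.
  by rewrite -ler_pdivlMr ?ge_min ?lexx ?orbT//; lra.
(* With kappa = a/q the exponent kappa (2d + 1) of 1/eps is a. *)
pose q : R := 2 * d%:R + 1.
have q1 : 1 <= q by rewrite /q lerDr mulr_ge0.
have kq : a / q * q = a by field; rewrite gt_eqF//; lra.
have k0 : 0 < a / q by rewrite divr_gt0//; lra.
have ka : a / q <= a by rewrite ler_pdivrMr; [rewrite ler_peMr// ltW|lra].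
have [C C0 HC] := gauss_covers_exp_rate A0 XA k0 (le_trans ka a1).
(* The weight of the sigma-dependent bound, solving a theta + 2 (1 - theta) = p. *)
pose theta := (1 - p / 2) / (1 - a / 2).
have th0 : 0 <= theta by rewrite divr_ge0//; lra.
have th1 : theta <= 1 by rewrite ler_pdivrMr; lra.
have thE : theta * (1 - a / 2) = 1 - p / 2 by rewrite /theta; field; lra.
exists (17 `^ (1 - theta) * C `^ theta); split; first by rewrite mulr_gt0// powR_gt0.
move=> sigma s1 H ip HK n eps n1 e0.
apply: ge_ereal_sup => _ [T _ <-].
have s0 : 0 < sigma by lra.
(* For eps >= 1 the single centre 0 suffices, with ln 1 = 0. *)
have [e1|e1] := leP 1 eps.
  apply: (@lne_covering_number_le _ _ _ _ _ 1).
    split=> //; exists (fun=> 0) => f Bf; exists ord0 => //=.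
    rewrite subr0 empirical_L2E; apply: le_trans e1.
    rewrite -[leRHS]sqrtr1 ler_wsqrtr//.
    exact: (emp_hilbert_ball HK (@gauss_kernel_diag _ _ _ _)).
  by rewrite ln1 !mulr_ge0 ?powR_ge0.
have [m1 cov1 ln1] := rkhs_covers_dimension_free HK (@gauss_kernel_diag _ _ _ _) T e0.
have [m2 cov2 ln2] := HC _ _ _ _ s1 HK e0 (ltW e1) _ T.
rewrite kq in ln2.
(* 1 + 16 eps^(-2) <= 17 eps^(-2) for eps <= 1. *)
have {}ln1 : ln m1%:R <= 17 * eps `^ (- 2).
  apply: le_trans ln1 _; rewrite powRN powR_mulrn ?(ltW e0)//.
  have : 1 <= (eps ^+ 2)^-1 by rewrite invf_ge1 ?exprn_gt0// exprn_ile1// ltW.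
  by lra.
(* The smaller of the two covers obeys both bounds. *)
have [m cov [lnm1 lnm2]] : exists2 m, covers (empirical_L2 T) (hilbert_ball H ip) eps m &
    ln m%:R <= 17 * eps `^ (- 2) /\
    ln m%:R <= C * sigma `^ ((1 + a / q) * d%:R) * eps `^ (- a).
  have [le|/ltW le] := leP (ln m1%:R : R) (ln m2%:R).
    by exists m1 => //; split=> //; exact: le_trans ln2.
  by exists m2 => //; split=> //; exact: le_trans ln1.
apply: lne_covering_number_le cov _.
have x0 : 0 < C * sigma `^ ((1 + a / q) * d%:R) * eps `^ (- a) by rewrite !mulr_gt0// powR_gt0.
have y0 : 0 < 17 * eps `^ (- 2) by rewrite mulr_gt0// powR_gt0.
apply: le_trans (interpolation_le x0 y0 lnm2 lnm1 th0 th1) _.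
rewrite !powRM ?mulr_ge0 ?powR_ge0// ?(ltW C0)// -!powRrM.
have es : eps `^ (- a * theta) * eps `^ (- 2 * (1 - theta)) = eps `^ (- p).
  rewrite -powRD; last by rewrite (gt_eqF e0) implybT.
  by congr (_ `^ _); lra.
(* (1 + a/q) theta <= (1 + a) theta <= (1 - a/2)(1 + delta) theta = (1 - p/2)(1 + delta). *)
have ss : sigma `^ ((1 + a / q) * d%:R * theta) <= sigma `^ ((1 - p / 2) * (1 + delta) * d%:R).
  apply: ler_powR => //; rewrite mulrAC ler_wpM2r//.
  rewrite -thE -mulrA mulrC ler_wpM2l//.
  have := ad; have := ka; lra.
rewrite -es.
set u := 17 `^ _; set v := C `^ _; set s' := sigma `^ _ in ss *; set s'' := sigma `^ _ in ss *.
set x := eps `^ _; set y := eps `^ _.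
rewrite (_ : _ * _ = u * v * s' * (x * y)); last by ring.
by rewrite ler_wpM2r ?mulr_ge0 ?powR_ge0// ler_wpM2l ?mulr_ge0 ?powR_ge0.
Qed.
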